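(* Let $(\Omega,\mathcal F,\mu)$ be a measure space, $p\in(1,\infty)$ and $r=\min\{p,2\}$. There is a constant $C>0$ depending only on $(\Omega,\mathcal F,\mu)$ and $p$ such that the following holds. If $\mathscr A\subset L^p(\Omega,\mathcal F,\mu)$ is uniformly approximable, then for every $K\ge0$ the set $\mathscr A_K=\{f\in\overline{\mathrm{co}}(\mathscr A):\ \|f-g\|_p\le K\ \text{for all } g\in\mathscr A\}$ is uniformly approximable, and for every $\varepsilon>0$, $$N_{p,\varepsilon}(\mathscr A_K)\le\min_{\eta\in(0,1)}\big(N_{p,(1-\eta)\varepsilon}(\mathscr A)\big)^{s(\eta)},\qquad s(\eta)=\Big\lfloor\Big(\tfrac{CK}{\eta\varepsilon}\Big)^{\frac{r}{r-1}}\Big\rfloor+1.$$ In particular, if $\mathscr A$ is bounded and uniformly approximable, then its closed convex hull $\overline{\mathrm{co}}(\mathscr A)$ is uniformly approximable.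
   Context: All measures are assumed not identically zero. $\mathscr G_{p,k}$ is the set of functions $\sum_{i=1}^l a_i\mathbf 1_{A_i}\in L^p$ with $l\le k$, $\{A_i\}$ a measurable partition of $\Omega$, $a_i\in\mathbb R$. $N_{p,\varepsilon}(\mathscr A)=\inf\{k\ge1:\ \forall f\in\mathscr A\ \exists h\in\mathscr G_{p,k},\ \|f-h\|_p\le\varepsilon\}$ ($\inf\emptyset=\infty$); $\mathscr A$ is uniformly approximable if this is finite for all $\varepsilon>0$. $\overline{\mathrm{co}}$ denotes the norm-closed convex hull. *)

(* Defs.v *)
From HB Require Import structures.
From mathcomp Require Import all_boot all_order all_algebra.
From mathcomp Require Import all_classical all_reals all_analysis.
Set Implicit Arguments. Unset Strict Implicit. Unset Printing Implicit Defensive.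
Import Order.TTheory GRing.Theory Num.Theory.
Local Open Scope classical_set_scope.
Local Open Scope ring_scope.

Section Defs.
Context d (T : measurableType d) (R : realType) (mu : {measure set T -> \bar R}).

Definition inLp (p : R) (f : T -> R) : Prop := f \in Lfun mu p%:E.

Definition Lpdist (p : R) (f g : T -> R) : \bar R := Lnorm mu p%:E (EFin \o (f \- g)).

Definition Gpk (p : R) (k : nat) : set (T -> R) :=
  [set h | inLp p h /\
    exists (l : nat) (a : nat -> R) (A : nat -> set T),
      [/\ (l <= k)%N,
          (forall i, (i < l)%N -> measurable (A i)),
          (forall i j, (i < l)%N -> (j < l)%N -> i <> j -> A i `&` A j = set0),
          \bigcup_(i in [set i | (i < l)%N]) A i = setT &
          h = (fun x => \sum_(i < l) a i * \1_(A i) x)]].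

Definition approx_by (p eps : R) (k : nat) (S : set (T -> R)) : Prop :=
  forall f, S f -> exists h, Gpk p k h /\ (Lpdist p f h <= eps%:E)%E.

(* N_{p,eps}(S) = inf {k >= 1 | ...}, inf of the empty set = +oo *)
Definition Npe (p eps : R) (S : set (T -> R)) : \bar R :=
  ereal_inf [set (k%:R)%:E | k in [set k : nat | (1 <= k)%N /\ approx_by p eps k S]].

Definition unif_approx (p : R) (S : set (T -> R)) : Prop :=
  forall eps, 0 < eps -> (Npe p eps S < +oo)%E.

Definition conv_hull (S : set (T -> R)) : set (T -> R) :=
  [set g | exists (n : nat) (lam : nat -> R) (fs : nat -> T -> R),
     [/\ (0 < n)%N,
         (forall i, (i < n)%N -> 0 <= lam i /\ S (fs i)),
         \sum_(i < n) lam i = 1 &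
         g = (fun x => \sum_(i < n) lam i * fs i x)]].

Definition closed_conv_hull (p : R) (S : set (T -> R)) : set (T -> R) :=
  [set f | inLp p f /\
     forall e, 0 < e -> exists g, conv_hull S g /\ (Lpdist p f g <= e%:E)%E].

Definition setAK (p K : R) (S : set (T -> R)) : set (T -> R) :=
  [set f | closed_conv_hull p S f /\ forall g, S g -> (Lpdist p f g <= K%:E)%E].

Definition Lp_bounded (p : R) (S : set (T -> R)) : Prop :=
  exists M : R, forall f, S f -> (Lnorm mu p%:E (EFin \o f) <= M%:E)%E.

End Defs.

Definition s_exp (R : realType) (p C K eps eta : R) : nat :=
  let r := Num.min p 2 in
  (Num.truncn ((C * K / (eta * eps)) `^ (r / (r - 1)))).+1.

(* Main.v *)
(* Maurey's empirical method.  If g is a convex combination of elements of S all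
   within distance K of g, then some average of n of these elements is within
   C K n^(1/r - 1) of g.  This follows from the smoothness inequality
     |a + b|^p <= (1 + C/n) |a|^p + c(a) b + C n^(p/r - 1) |b|^p :
   averaged over b = f_i - g with the convex weights, the linear term vanishes,
   so after integration one of the f_i can be added to the running sum with
   controlled growth.  Iterating n times costs a factor (1 + C/n)^n <= e^C.
   Replacing each chosen element by a simple function with at most k values
   gives an average with at most k^n values. *)
Require Import Defs.
From HB Require Import structures.
From mathcomp Require Import all_boot all_order all_algebra.
From mathcomp Require Import all_classical all_reals all_analysis.
From mathcomp Require Import measurable_realfun ring lra.
Set Implicit Arguments.
Unset Strict Implicit.
Unset Printing Implicit Defensive.
Import Order.TTheory GRing.Theory Num.Theory.
Local Open Scope classical_set_scope.
Local Open Scope ring_scope.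

(** * Scalar smoothness inequality for [|.|^p] *)

(** Since [expR (- x) >= 1 - x], the left side is at most [(1 - x)^-1], and [(1 - x)(1 + x + 2x^2) =
    1 + x^2 (1 - 2x) >= 1]. *)
Lemma expR_le_quadratic (R : realType) (x : R) :
  `|x| <= 2^-1 -> expR x <= 1 + x + 2 * x ^+ 2.
Proof.
rewrite ler_norml => /andP[lx ux].
have x1 : 0 < 1 - x by lra.
have : expR x <= (1 - x)^-1.
  by rewrite -[x in expR x]opprK expRN lef_pV2 ?posrE ?expR_gt0 ?expR_ge1Dx.
move/le_trans; apply.
rewrite -(ler_pM2r x1) mulVf ?gt_eqF//.
have : 0 <= x ^+ 2 * (1 - 2 * x) by rewrite mulr_ge0 ?sqr_ge0//; lra.
by lra.
Qed.

(** For [p <= 2] the power of [N] is 1 and [t^2 <= |t|^p]. For [p > 2], either [t^2 <= N^-1], or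
    [N t^2 > 1] and multiplying [t^2] by [(N t^2)^(p/2 - 1) >= 1] gives the second term. *)
Lemma sqr_le_powR_interpolation (R : realType) (p N t : R) :
  1 < p -> 1 <= N -> `|t| <= 1 ->
  t ^+ 2 <= N^-1 + N `^ (p / Num.min p 2 - 1) * `|t| `^ p.
Proof.
move=> p1 N1 t1.
have p0 : 0 < p by lra.
have N0 : 0 < N by lra.
have -> : t ^+ 2 = `|t| `^ 2 by rewrite powR_mulrn// real_normK// num_real.
have [->|t0] := eqVneq t 0.
  by rewrite normr0 !powR0 ?pnatr_eq0// ?gt_eqF// mulr0 addr0 invr_ge0 ltW.
have nt0 : 0 < `|t| by rewrite normr_gt0.
have [p2|p2] := leP p 2.
  rewrite divff ?gt_eqF// subrr powRr0 mul1r.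
  rewrite -[leLHS]add0r lerD ?invr_ge0 ?(ltW N0)//.
  by rewrite ger_powR ?nt0.
have [tN|tN] := leP (`|t| `^ 2) N^-1.
  by rewrite -[leLHS]addr0 lerD// mulr_ge0 ?powR_ge0.
rewrite -[leLHS]add0r lerD ?invr_ge0 ?(ltW N0)//.
set q := p / 2 - 1.
have q0 : 0 <= q by rewrite /q subr_ge0 ler_pdivlMr//; lra.
have -> : p = 2 * q + 2 by rewrite /q; field.
rewrite (@powRD _ `|t| (2 * q)); last by rewrite (gt_eqF nt0) implybT.
rewrite powRrM mulrA -powRM ?powR_ge0 ?(ltW N0)//.
rewrite ler_peMl ?powR_ge0//.
rewrite -[leLHS](powRr0 (N * `|t| `^ 2)) ler_powR//.
by rewrite mulrC -ler_pdivrMr// div1r ltW.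
Qed.

(** Each summand of [C] pays for one estimate: [2 p^2] for the quadratic term of [expR (p t)] at
    small [t], [(2p + 1)^p] for [|1 + t|^p] and [(2p)^p] for a negative [1 + p t] at large [t]. *)
Lemma powR_smooth1 (R : realType) (p N t : R)
    (C := (2 * p + 1) `^ p + (2 * p) `^ p + 2 * p ^+ 2) :
  1 < p -> 1 <= N ->
  `|1 + t| `^ p <=
    1 + C / N + p * t + C * N `^ (p / Num.min p 2 - 1) * `|t| `^ p.
Proof.
move=> p1 N1.
have p0 : 0 < p by lra.
have N0 : 0 < N by lra.
set q := p / Num.min p 2 - 1.
have q0 : 0 <= q.
  rewrite /q subr_ge0 ler_pdivlMr; first by rewrite mul1r ge_min lexx.
  by rewrite lt_min p0/=; lra.
have c1 : 0 <= (2 * p + 1) `^ p by exact: powR_ge0.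
have c2 : 0 <= (2 * p) `^ p by exact: powR_ge0.
have c3 : 0 <= 2 * p ^+ 2 by rewrite mulr_ge0// sqr_ge0.
have CN : 0 <= C / N by rewrite divr_ge0 ?(ltW N0)// /C; lra.
have Nq : 1 <= N `^ q by rewrite -[leLHS](powRr0 N) ler_powR.
have tp0 : 0 <= `|t| `^ p by exact: powR_ge0.
(* For small t, (1 + t)^p <= e^(pt) is quadratic; otherwise |t|^p dominates. *)
have [tp|tp] := leP `|2 * p * t| 1.
  have pt2 : `|t * p| <= 2^-1.
    by move: tp; rewrite -mulrA (normrM 2) (mulrC p) normr_nat; lra.
  have t1 : `|t| <= 2^-1.
    apply: le_trans pt2; rewrite normrM ler_peMr// gtr0_norm//; lra.
  have /andP[t2 t3] : - 2^-1 <= t <= 2^-1 by rewrite -ler_norml.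
  have : `|1 + t| `^ p <= expR (t * p).
    rewrite expRM ger0_norm; last by lra.
    by rewrite ge0_ler_powR ?nnegrE ?expR_ge0 ?expR_ge1Dx//; lra.
  move/le_trans; apply; apply: (le_trans (expR_le_quadratic pt2)).
  have := @sqr_le_powR_interpolation R p N t p1 N1.
  have /[swap]/[apply] : `|t| <= 1 by lra.
  rewrite -/q => H.
  have : 2 * p ^+ 2 * t ^+ 2 <= C * (N^-1 + N `^ q * `|t| `^ p).
    apply: ler_pM => //; rewrite ?sqr_ge0// /C; lra.
  rewrite mulrDr mulrA exprMn; lra.
have np : `|2 * p * t| = 2 * p * `|t| by rewrite normrM ger0_norm//; lra.
have nt0 : 0 < `|t|.
  by rewrite normr_gt0; apply: contraTneq tp => ->; rewrite mulr0 normr0 ltr10.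
have h1 : `|1 + t| `^ p <= (2 * p + 1) `^ p * `|t| `^ p.
  rewrite -powRM ?ge0_ler_powR ?nnegrE ?mulr_ge0//; try lra.
  by rewrite (le_trans (ler_normD _ _))// normr1 mulrDl mul1r -np; lra.
have h2 : - (1 + p * t) <= (2 * p) `^ p * `|t| `^ p.
  rewrite -powRM//; last by lra.
  rewrite -np; apply: le_trans (le1r_powR (ltW tp) (ltW p1)).
  have := ler_norm (- t); rewrite normrN => ht.
  have : p * - t <= p * `|t| by rewrite ler_pM2l.
  have : 0 <= p * `|t| by rewrite mulr_ge0// ltW.
  by rewrite np; lra.
have h3 : C * `|t| `^ p <= C * N `^ q * `|t| `^ p.
  rewrite ler_wpM2r// ler_peMr// /C; lra.
have h4 : 0 <= 2 * p ^+ 2 * `|t| `^ p by rewrite mulr_ge0.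
move: h3; rewrite {1}/C; lra.
Qed.

(** By homogeneity this is the case [a = 1] at [t = b / a], scaled by [|a|^p]; [c] is then the
    derivative of [|.|^p] at [a]. For [a = 0], [c = 0] works because [C N^(p/r - 1) >= 1], with
    [r = min(p, 2)]. *)
Lemma powR_smooth (R : realType) (p : R) : 1 < p ->
  exists2 C : R, 0 < C & forall N a : R, 1 <= N -> exists c : R, forall b,
    `|a + b| `^ p <= (1 + C / N) * `|a| `^ p + c * b
                     + C * N `^ (p / Num.min p 2 - 1) * `|b| `^ p.
Proof.
move=> p1.
exists ((2 * p + 1) `^ p + (2 * p) `^ p + 2 * p ^+ 2).
  have := powR_ge0 (2 * p + 1) p; have := powR_ge0 (2 * p) p.
  have : 0 < p ^+ 2 by rewrite exprn_gt0//; lra.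
  by lra.
set C := (2 * p + 1) `^ p + (2 * p) `^ p + 2 * p ^+ 2.
move=> N a N1; have [->|a0] := eqVneq a 0.
  exists 0 => b; rewrite add0r normr0 powR0 ?mulr0 ?mul0r ?add0r; last by rewrite gt_eqF//; lra.
  rewrite ler_peMl ?powR_ge0// mulr_ege1//.
    have : 1 <= (2 * p + 1) `^ p by rewrite -[leLHS](powRr0 (2 * p + 1)) ler_powR; lra.
    have := powR_ge0 (2 * p) p; have := sqr_ge0 p.
    by rewrite /C; lra.
  rewrite -[leLHS](powRr0 N) ler_powR// subr_ge0 ler_pdivlMr ?mul1r ?ge_min ?lexx//.
  by rewrite lt_min; apply/andP; split; lra.
exists (p * `|a| `^ p / a) => b.
have -> : a + b = a * (1 + b / a) by rewrite mulrDr mulr1 mulrCA divff ?mulr1.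
have -> : `|b| = `|a| * `|b / a| by rewrite -normrM mulrCA divff ?mulr1.
rewrite normrM !(@powRM _ `|a|)//.
apply: le_trans (ler_wpM2l (powR_ge0 _ _) (@powR_smooth1 R p N (b / a) p1 N1)) _.
rewrite -/C le_eqVlt; apply/orP; left; apply/eqP. field.
by rewrite a0 gt_eqF//; lra.
Qed.

(** * Greedy selection of elements with controlled p-th power integral *)

(** The index minimizing [e] works: a minimum is at most any weighted mean. This replaces the
    probabilistic choice in Maurey's argument. *)
Lemma le_average (R : realType) m (lam : 'I_m -> R) (e : 'I_m -> \bar R) (V : \bar R) :
  (forall i, 0 <= lam i) -> \sum_i lam i = 1 -> (forall i, (0 <= e i)%E) ->
  (\sum_i (lam i)%:E * e i <= V)%E -> exists i, (e i <= V)%E.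
Proof.
case: m lam e => [lam e _ /eqP|m lam e lam0 lam1 e0 leV].
  by rewrite big_ord0 eq_sym oner_eq0.
case: (@Order.TotalTheory.arg_minP _ _ _ ord0 xpredT e isT) => i _ imin; exists i.
apply: le_trans leV; rewrite -[leLHS]mul1e -lam1 -sumEFin.
rewrite ge0_sume_distrl; last by move=> j _; rewrite lee_fin.
by apply: lee_sum => j _; rewrite lee_wpmul2l ?lee_fin// imin.
Qed.

(** The p-th power of the norm is used because the pointwise smoothness inequality integrates
    directly against it. *)
Definition powint {d : measure_display} {T : measurableType d} {R : realType}
  (mu : {measure set T -> \bar R}) (p : R) (f : T -> R) : \bar R :=
  (\int[mu]_x (`|f x| `^ p)%:E)%E.

Section powint.
Context (d : measure_display) (T : measurableType d) (R : realType).
Variables (mu : {measure set T -> \bar R}) (p : R).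

Local Notation W := (powint mu p).

Lemma measurable_normr_powR (f : T -> R) : measurable_fun setT f ->
  measurable_fun setT (fun x => (`|f x| `^ p)%:E).
Proof.
move=> mf; apply/measurable_EFinP.
apply: (@measurableT_comp _ _ _ _ _ _ (@powR R ^~ p)) => //.
exact: measurableT_comp.
Qed.

(** Average the smoothness inequality at [a = u x], [b = Y i x] over the weights. The linear term
    vanishes pointwise in [x], before integration, so [c] is only ever chosen at one point at a
    time. *)
Lemma powint_step (A B M U : R) m (lam : 'I_m -> R) (u : T -> R) (Y : 'I_m -> T -> R) :
  0 <= A -> 0 <= B ->
  (forall a : R, exists c, forall b,
    `|a + b| `^ p <= A * `|a| `^ p + c * b + B * `|b| `^ p) ->
  (forall i, 0 <= lam i) -> \sum_i lam i = 1 ->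
  (forall x, \sum_i lam i * Y i x = 0) ->
  measurable_fun setT u -> (forall i, measurable_fun setT (Y i)) ->
  (W u <= U%:E)%E -> (forall i, W (Y i) <= M%:E)%E ->
  exists i, (W (u \+ Y i)%R <= (A * U + B * M)%:E)%E.
Proof.
move=> A0 B0 smooth lam0 lam1 Y0 mu_ mY uU YM.
have mW (f : T -> R) : measurable_fun setT f -> measurable_fun setT (fun x => (`|f x| `^ p)%:E).
  exact: measurable_normr_powR.
have mZ k (f : T -> R) : measurable_fun setT f ->
    measurable_fun setT (fun x => k%:E * (`|f x| `^ p)%:E)%E.
  by move=> mf; apply: emeasurable_funM => //; exact: mW.
have W0 x (f : T -> R) (k : R) : 0 <= k -> (0 <= k%:E * (`|f x| `^ p)%:E)%E.
  by move=> k0; rewrite mule_ge0 ?lee_fin ?powR_ge0.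
have intsum (f : 'I_m -> T -> R) : (forall i, measurable_fun setT (f i)) ->
    (\sum_i (lam i)%:E * W (f i) = \int[mu]_x \sum_i (lam i)%:E * (`|f i x| `^ p)%:E)%E.
  move=> mf; rewrite ge0_integral_sum//; last by move=> i x _; exact: W0.
    by apply: eq_bigr => i _; rewrite ge0_integralZl_EFin//; exact: mW.
  by move=> i; exact: mZ.
have mS (f : 'I_m -> T -> R) : (forall i, measurable_fun setT (f i)) ->
    measurable_fun setT (fun x => \sum_i (lam i)%:E * (`|f i x| `^ p)%:E)%E.
  by move=> mf; apply: emeasurable_sum => i; exact: mZ.
have muY i : measurable_fun setT (u \+ Y i) by exact: measurable_funD.
apply: (@le_average _ _ lam (fun i => W (u \+ Y i)%R)) => // [i|].
  by apply: integral_ge0 => x _; rewrite lee_fin powR_ge0.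
rewrite intsum//.
(* This middle term is at most [A U + B M] since the weights sum to 1; it remains to compare
   integrands. *)
apply: (@le_trans _ _ (A%:E * W u + B%:E * \sum_i (lam i)%:E * W (Y i))%E); last first.
  rewrite EFinD !EFinM leeD// ?lee_wpmul2l ?lee_fin//.
  rewrite -[M%:E]mul1e -lam1 -sumEFin ge0_sume_distrl; last by move=> i _; rewrite lee_fin.
  by apply: lee_sum => i _; rewrite lee_wpmul2l ?lee_fin.
have Y1 x : (0 <= B%:E * \sum_i (lam i)%:E * (`|Y i x| `^ p)%:E)%E.
  by rewrite mule_ge0 ?lee_fin// sume_ge0// => i _; exact: W0.
rewrite intsum// /powint -!ge0_integralZl_EFin//; first last.
- exact: mW.
- exact: mS.
- by move=> x _; rewrite sume_ge0// => i _; exact: W0.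
rewrite -ge0_integralD//; first last.
- by apply: emeasurable_funM => //; exact: mS.
- exact: mZ.
- by move=> x _; exact: W0.
apply: ge0_le_integral => //.
- by move=> x _; rewrite sume_ge0// => i _; exact: W0.
- exact: mS.
- apply: emeasurable_funD; first exact: mZ.
  by apply: emeasurable_funM => //; exact: mS.
move=> x _; have [c hc] := smooth (u x).
under eq_bigr do rewrite -EFinM.
under [X in (_ <= _ + _ * X)%E]eq_bigr do rewrite -EFinM.
rewrite !sumEFin -!EFinM -EFinD lee_fin.
apply: (@le_trans _ _ (\sum_i lam i * (A * `|u x| `^ p + c * Y i x + B * `|Y i x| `^ p))).
  by apply: ler_sum => i _; rewrite ler_wpM2l//=; exact: hc.
rewrite le_eqVlt; apply/orP; left; apply/eqP.
transitivity ((\sum_i lam i) * (A * `|u x| `^ p) + c * (\sum_i lam i * Y i x)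
   + B * \sum_i lam i * `|Y i x| `^ p); last by rewrite lam1 mul1r Y0 mulr0 addr0.
rewrite mulr_suml !mulr_sumr -!big_split/=; apply: eq_bigr => i _; ring.
Qed.

Lemma powint0 : p != 0 -> W (fun=> 0) = 0%E.
Proof.
move=> p0; rewrite /powint.
by under eq_integral do rewrite normr0 powR0//; rewrite integral0.
Qed.

(** Each step turns a bound [U] into [A U + B M]. As [A >= 1], the new term [B M] is at most
    [A^(n+1) B M], which gives the closed form by induction. Elements of [S] may be chosen
    repeatedly. *)
Lemma powint_greedy (A B M : R) (S : set (T -> R)) (g : T -> R) :
  p != 0 -> 1 <= A -> 0 <= B -> 0 <= M ->
  (forall a : R, exists c, forall b,
    `|a + b| `^ p <= A * `|a| `^ p + c * b + B * `|b| `^ p) ->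
  (forall f, S f -> measurable_fun setT f) -> measurable_fun setT g ->
  conv_hull S g -> (forall f, S f -> (W (f \- g)%R <= M%:E)%E) ->
  forall n, exists F : nat -> T -> R, (forall i, (i < n)%N -> S (F i)) /\
    (W (fun x => \sum_(i < n) (F i x - g x))%R
      <= (n%:R * A ^+ n * B * M)%:E)%E.
Proof.
move=> p0 A1 B0 M0 smooth Sm mg [m [lam [fs [m0 lamfs lam1 gE]]]] SM.
elim=> [|n [F [FS FW]]].
  exists (fun=> g); split=> //; rewrite !mul0r -/(0%:E) (_ : (fun x => _) = fun=> 0).
    by rewrite powint0.
  by apply/funext => x; rewrite big_ord0.
set u := fun x => _ in FW.
(* Only the first [n] terms of [F] are known to lie in [S], so the others are replaced by 0. *)
have mF i : measurable_fun setT (fun x : T => if (i < n)%N then F i x - g x else 0).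
  have [/FS /Sm mFi|_] := boolP (i < n)%N => //; exact: measurable_funB.
have mu_ : measurable_fun setT u.
  rewrite (_ : u = fun x => \sum_(i < n) if (i < n)%N then F i x - g x else 0).
    by apply: measurable_sum => i; exact: mF.
  by apply/funext => x; apply: eq_bigr => i _; rewrite ltn_ord.
have fsS (i : 'I_m) : S (fs i) by case: (lamfs i (ltn_ord i)).
have [] := @powint_step A B M (n%:R * A ^+ n * B * M) m (fun i => lam i) u
  (fun i => fs i \- g)%R _ B0 smooth _ lam1 _ mu_ _ FW _.
- exact: le_trans A1.
- by move=> i; case: (lamfs i (ltn_ord i)).
- move=> x; under eq_bigr do rewrite /= mulrBr.
  by rewrite sumrB -mulr_suml lam1 mul1r gE subrr.
- by move=> i; apply: measurable_funB => //; exact: Sm.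
- by move=> i; exact: SM.
move=> i0 Wi0; exists (fun i => if (i < n)%N then F i else fs i0); split.
  by move=> i _; case: ifPn => [/FS//|_].
rewrite (_ : (fun x => _) = u \+ (fs i0 \- g)); last first.
  apply/funext => x; rewrite big_ord_recr/= ltnn; congr (_ + _).
  by apply: eq_bigr => i _; rewrite ltn_ord.
apply: le_trans Wi0 _; rewrite lee_fin.
have An : 1 <= A ^+ n.+1 by rewrite exprn_ege1.
have : B * M <= A ^+ n.+1 * B * M.
  by rewrite -mulrA ler_peMl// mulr_ge0.
rewrite exprS -natr1; lra.
Qed.

End powint.

(** * Norm estimates in L^p and Maurey's approximation rate *)

Section Lp.
Context (d : measure_display) (T : measurableType d) (R : realType).
Variables (mu : {measure set T -> \bar R}) (p : R).
Hypothesis p1 : 1 < p.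

Local Notation W := (powint mu p).
Local Notation N f := (Lnorm mu p%:E (EFin \o f)).

Let p0 : 0 < p. Proof. exact: lt_trans p1. Qed.

Lemma inLpP f : inLp mu p f <-> measurable_fun setT f /\ (N f < +oo)%E.
Proof.
rewrite /inLp inE; split.
  by case/andP; rewrite !inE/= => mf Nf; split.
by case=> mf Nf; apply/andP; rewrite !inE.
Qed.

Lemma powint_ge0 f : (0 <= W f)%E.
Proof. by apply: integral_ge0 => x _; rewrite lee_fin powR_ge0. Qed.

Lemma powint_Lnorm f : (N f `^ p)%E = W f.
Proof.
by rewrite poweR_Lnorm ?gt_eqF.
Qed.

Lemma Lnorm_powint f : N f = (W f `^ p^-1)%E.
Proof.
by rewrite -powint_Lnorm -poweRrM divff ?gt_eqF// poweRe1 ?Lnorm_ge0.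
Qed.

Lemma Lnorm_lee (K : R) f : 0 <= K -> (N f <= K%:E)%E = (W f <= (K `^ p)%:E)%E.
Proof.
move=> K0.
apply/idP/idP => h.
  rewrite -powint_Lnorm -poweR_EFin gt0_ler_poweR ?(ltW p0)// in_itv/= ?Lnorm_ge0 ?leey//.
  by rewrite lee_fin K0.
rewrite Lnorm_powint -[K]powRr1// -(divff (lt0r_neq0 p0)) powRrM -poweR_EFin.
by rewrite gt0_ler_poweR ?invr_ge0 ?(ltW p0)// in_itv/= ?powint_ge0 ?leey// lee_fin powR_ge0.
Qed.

Lemma powintZ (c : R) f : measurable_fun setT f ->
  W (fun x => c * f x) = ((`|c| `^ p)%:E * W f)%E.
Proof.
move=> mf; rewrite /powint -ge0_integralZl_EFin ?powR_ge0//.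
- by apply: eq_integral => x _; rewrite normrM powRM.
- exact: measurable_normr_powR.
Qed.

Lemma LnormZl (c : R) f : measurable_fun setT f ->
  N (fun x => c * f x) = (`|c|%:E * N f)%E.
Proof.
move=> mf; rewrite !Lnorm_powint powintZ// poweRM ?lee_fin ?powR_ge0 ?powint_ge0//.
by rewrite poweR_EFin -powRrM divff ?gt_eqF// powRr1.
Qed.

Lemma Lpdist_triangle f g h : measurable_fun setT f -> measurable_fun setT g ->
  measurable_fun setT h ->
  (Lpdist mu p f h <= Lpdist mu p f g + Lpdist mu p g h)%E.
Proof.
move=> mf mg mh; rewrite /Lpdist (_ : f \- h = (f \- g) \+ (g \- h)).
  by apply: minkowski_EFin => //; [exact: measurable_funB|exact: measurable_funB|exact: ltW].
by apply/funext => x /=; ring.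
Qed.

Lemma LpdistC f g : Lpdist mu p f g = Lpdist mu p g f.
Proof.
rewrite /Lpdist -oppe_Lnorm; apply: eq_Lnorm => x /=.
by rewrite opprB.
Qed.

Lemma Lnorm_sum (n : nat) (F : 'I_n -> T -> R) (e : 'I_n -> R) :
  (forall i, measurable_fun setT (F i)) -> (forall i, (N (F i) <= (e i)%:E)%E) ->
  (N (fun x => \sum_i F i x)%R <= (\sum_i e i)%:E)%E.
Proof.
elim: n F e => [F e _ _|n IH F e mF Fe].
  rewrite big_ord0 (_ : (fun x => _) = cst 0).
    by rewrite [X in Lnorm _ _ X](_ : _ = cst 0%E) ?Lnorm0// ?eqe ?gt_eqF.
  by apply/funext => x; rewrite big_ord0.
rewrite (_ : (fun x => _) = F ord0 \+ (fun x => \sum_i F (lift ord0 i) x)); last first.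
  by apply/funext => x; rewrite big_ord_recl.
apply: le_trans (minkowski_EFin _ _ _ (ltW p1)) _ => //.
  by apply: measurable_sum => i; exact: mF.
by rewrite big_ord_recl EFinD leeD// IH.
Qed.

Lemma conv_hull_measurable (S : set (T -> R)) g :
  S `<=` inLp mu p -> conv_hull S g -> measurable_fun setT g.
Proof.
move=> SLp [n [lam [fs [_ fsS _ ->]]]].
apply: measurable_sum => i; apply: measurable_funM => //.
by have [_ /SLp/inLpP[]] := fsS i (ltn_ord i).
Qed.

(** Isolating [C] makes it uniform in [S], [g], [K] and [n]. The rate [n^(1/r - 1)] corresponds to
    the Rademacher type [r = min(p, 2)] of L^p. *)
Definition maurey_constant (C : R) : Prop :=
  forall (S : set (T -> R)) (g : T -> R) (K : R) (n : nat),
  S `<=` inLp mu p -> conv_hull S g -> 0 <= K ->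
  (forall f, S f -> (Lpdist mu p f g <= K%:E)%E) -> (0 < n)%N ->
  exists F : nat -> T -> R, (forall i, (i < n)%N -> S (F i)) /\
    (Lpdist mu p g (fun x => n%:R^-1 * \sum_(i < n) F i x)%R
      <= (C * K * n%:R `^ ((Num.min p 2)^-1 - 1))%:E)%E.

(** The greedy bound with [A = 1 + C/n], [B = C n^(p/r - 1)], [M = K^p] is at most
    [C e^C K^p n^(p/r)]. Dividing the sum by [n] contributes [n^(-p)], and the p-th root gives the
    rate with constant [(C e^C)^(1/p)]. *)
Lemma maurey : exists2 C : R, 0 < C & maurey_constant C.
Proof.
have [C C0 smooth] := powR_smooth p1.
have D0 : 0 < C * expR C by rewrite mulr_gt0 ?expR_gt0.
exists ((C * expR C) `^ p^-1); first by rewrite powR_gt0.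
move=> S g K n SLp gS K0 SK n0.
have n1 : 1 <= n%:R :> R by rewrite ler1n.
have n0' : 0 < n%:R :> R by rewrite ltr0n.
have mS f : S f -> measurable_fun setT f by move=> /SLp/inLpP[].
have mg := conv_hull_measurable SLp gS.
set r := Num.min p 2.
have Cn0 : 0 <= C * n%:R `^ (p / r - 1) by rewrite mulr_ge0 ?powR_ge0// ltW.
have A1 : 1 <= 1 + C / n%:R by rewrite lerDl divr_ge0// ltW.
have [|F [FS FW]] := powint_greedy (mu := mu) (lt0r_neq0 p0) A1 Cn0 (powR_ge0 K p)
  (fun a => smooth _ a n1) mS mg gS _ n.
  by move=> f Sf; rewrite -Lnorm_lee//; exact: SK.
exists F; split=> //.
have : ((C * expR C) `^ p^-1) `^ p = C * expR C.
  by rewrite -powRrM mulVf ?gt_eqF// powRr1// ltW.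
(* From here on the constant is a nonnegative [D] known only through [D^p = C e^C]. *)
have := powR_ge0 (C * expR C) p^-1; move: (_ `^ p^-1) => D D0' DE.
set B := _ * n%:R `^ _.
have B0 : 0 <= B by rewrite !mulr_ge0 ?powR_ge0.
have mF (i : 'I_n) : measurable_fun setT (F i \- g).
  by apply: measurable_funB => //; exact/mS/FS.
rewrite LpdistC /Lpdist Lnorm_lee//
  (_ : _ \- _ = fun x => n%:R^-1 * \sum_(i < n) (F i x - g x)); last first.
  apply/funext => x /=; rewrite sumrB mulrBr; congr (_ - _).
  by rewrite sumr_const card_ord -[g x *+ n]mulr_natl mulKf// gt_eqF.
rewrite powintZ; last by apply: measurable_sum => i; exact: mF.
apply: le_trans (lee_wpmul2l _ FW) _; first by rewrite lee_fin powR_ge0.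
rewrite -EFinM lee_fin /B !powRM ?powR_ge0 ?mulr_ge0 ?powR_ge0 //.
rewrite DE.
rewrite ger0_norm ?invr_ge0 ?ler0n// -!powRrM.
have -> : n%:R^-1 `^ p = n%:R `^ (-1 * p) :> R by rewrite powRrM powR_inv1.
have -> : n%:R `^ ((r^-1 - 1) * p) = n%:R `^ (-1 * p) * (n%:R * n%:R `^ (p / r - 1)) :> R.
  rewrite -[X in _ * (X * _)](@powRr1 _ n%:R) ?ler0n// -!powRD ?(gt_eqF n0') ?implybT//.
  by congr (_ `^ _); ring.
have : (1 + C / n%:R) ^+ n <= expR C.
  rewrite -[X in expR X](divfK (lt0r_neq0 n0')) expRM_natr.
  by rewrite lerXn2r ?nnegrE ?expR_ge0 ?expR_ge1Dx// (le_trans _ A1).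
move=> h; rewrite !mulrA [leRHS]mulrAC.
set X := _ `^ (-1 * p); set Y := n%:R `^ _; set Z := K `^ p.
have := ler_wpM2l (_ : 0 <= X * n%:R * Y * Z * C) h.
have -> : 0 <= X * n%:R * Y * Z * C by rewrite !mulr_ge0 ?powR_ge0// ltW.
by move=> /(_ isT); lra.
Qed.

(** The triangle inequality adds [n] errors [e] and the factor [1/n] undoes it. *)
Lemma Lpdist_mean (n : nat) (F H : nat -> T -> R) (e : R) : (0 < n)%N ->
  (forall i, (i < n)%N -> measurable_fun setT (F i)) ->
  (forall i, (i < n)%N -> measurable_fun setT (H i)) ->
  (forall i, (i < n)%N -> (Lpdist mu p (F i) (H i) <= e%:E)%E) ->
  (Lpdist mu p (fun x => n%:R^-1 * \sum_(i < n) F i x)%R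
    (fun x => n%:R^-1 * \sum_(i < n) H i x)%R <= e%:E)%E.
Proof.
move=> n0 mF mH FHe; have n0' : 0 < n%:R :> R by rewrite ltr0n.
have mFH (i : 'I_n) : measurable_fun setT (F i \- H i).
  by apply: measurable_funB; [exact: mF|exact: mH].
rewrite /Lpdist (_ : _ \- _ = fun x => n%:R^-1 * \sum_(i < n) (F i \- H i) x); last first.
  by apply/funext => x /=; rewrite sumrB mulrBr.
rewrite LnormZl; last exact: measurable_sum.
rewrite ger0_norm ?invr_ge0 ?ler0n//.
have /(lee_wpmul2l _) := @Lnorm_sum n (fun i => F i \- H i) (fun=> e)
  mFH (fun i => FHe i (ltn_ord i)).
move=> /(_ n%:R^-1%:E); rewrite lee_fin invr_ge0 ler0n => /(_ isT)/le_trans; apply.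
by rewrite sumr_const card_ord -EFinM -[e *+ n]mulr_natl mulKf// gt_eqF.
Qed.

End Lp.

(** * Simple functions on partitions and the approximation numbers *)

Lemma sum_indic_partition (T : Type) (R : realType) (l : nat) (a : nat -> R)
    (A : nat -> set T) (i : nat) (x : T) :
  (forall i j, (i < l)%N -> (j < l)%N -> i <> j -> A i `&` A j = set0) ->
  (i < l)%N -> A i x -> \sum_(j < l) a j * \1_(A j) x = a i.
Proof.
move=> tA il Aix; rewrite (bigD1 (Ordinal il))//= indicE mem_set// mulr1.
rewrite big1 ?addr0// => j /eqP ji; rewrite indicE memNset ?mulr0// => Ajx.
have ij : i <> j by move=> ij; apply: ji; exact/val_inj.
by have : (A i `&` A j) x by []; rewrite tA.
Qed.

Section approx.
Context (d : measure_display) (T : measurableType d) (R : realType).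
Variables (mu : {measure set T -> \bar R}) (p : R).
Hypothesis p1 : 1 < p.

Let p0 : 0 < p. Proof. exact: lt_trans p1. Qed.

Lemma inLp_measurable f : inLp mu p f -> measurable_fun setT f.
Proof. by case/inLpP. Qed.

Lemma inLpD f g : inLp mu p f -> inLp mu p g -> inLp mu p (f \+ g).
Proof.
move=> /inLpP[mf Nf] /inLpP[mg Ng].
apply/inLpP; split; first exact: measurable_funD.
by apply: le_lt_trans (minkowski_EFin _ _ _ (ltW p1)) _ => //; exact: lte_add_pinfty.
Qed.

Lemma inLpZ (c : R) f : inLp mu p f -> inLp mu p (fun x => c * f x).
Proof.
move=> /inLpP[mf Nf].
apply/inLpP; split; first exact: measurable_funM.
by rewrite LnormZl// lte_mul_pinfty// lee_fin.
Qed.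

Lemma Gpk0 : Gpk mu p 1 (fun=> 0).
Proof.
split.
  apply/inLpP; split; first exact: measurable_cst.
  by rewrite [X in Lnorm _ _ X](_ : _ = cst 0%E)// Lnorm0// eqe gt_eqF.
exists 1%N, (fun=> 0), (fun=> setT); split=> //.
- by move=> i j; rewrite !ltnS !leqn0 => /eqP-> /eqP->.
- by apply/seteqP; split=> // x _; exists 0%N.
- by apply/funext => x; rewrite big_ord1 mul0r.
Qed.

Lemma GpkZ (k : nat) (c : R) h : Gpk mu p k h -> Gpk mu p k (fun x => c * h x).
Proof.
move=> [hLp [l [a [A [lk mA tA UA hE]]]]]; split; first exact: inLpZ.
exists l, (fun i => c * a i), A; split=> //.
by apply/funext => x; rewrite hE mulr_sumr; apply: eq_bigr => i _; rewrite mulrA.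
Qed.

(** The sum is constant on the cells of the common refinement. The pair [(i1, i2)] is coded as
    [i1 * l2 + i2] and decoded by quotient and remainder; empty cells are harmless. *)
Lemma GpkD (k1 k2 : nat) h1 h2 :
  Gpk mu p k1 h1 -> Gpk mu p k2 h2 -> Gpk mu p (k1 * k2) (h1 \+ h2).
Proof.
move=> [h1Lp [l1 [a1 [A1 [lk1 mA1 tA1 UA1 h1E]]]]].
move=> [h2Lp [l2 [a2 [A2 [lk2 mA2 tA2 UA2 h2E]]]]].
split; first exact: inLpD.
pose A i := A1 (i %/ l2)%N `&` A2 (i %% l2)%N.
have div_lt i : (i < l1 * l2)%N -> (i %/ l2 < l1)%N /\ (i %% l2 < l2)%N.
  move=> il; have l20 : (0 < l2)%N by case: (l2) il => //; rewrite muln0.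
  by rewrite ltn_mod ltn_divLR.
have tA i j : (i < l1 * l2)%N -> (j < l1 * l2)%N -> i <> j -> A i `&` A j = set0.
  move=> /div_lt[i1 i2] /div_lt[j1 j2] ij; rewrite /A setIACA.
  have [e1|/eqP n1] := eqVneq (i %/ l2)%N (j %/ l2)%N; last by rewrite tA1 ?set0I.
  have [e2|/eqP n2] := eqVneq (i %% l2)%N (j %% l2)%N; last by rewrite tA2 ?setI0.
  by case: ij; rewrite (divn_eq i l2) (divn_eq j l2) e1 e2.
have coverA x : exists i1 i2, [/\ (i1 < l1)%N, (i2 < l2)%N, A1 i1 x, A2 i2 x &
    (i1 * l2 + i2 < l1 * l2)%N /\ A (i1 * l2 + i2)%N x].
  have [i1 /= i1l Ai1] : (\bigcup_(i in [set i | (i < l1)%N]) A1 i) x by rewrite UA1.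
  have [i2 /= i2l Ai2] : (\bigcup_(i in [set i | (i < l2)%N]) A2 i) x by rewrite UA2.
  have l20 : (0 < l2)%N by apply: leq_ltn_trans i2l.
  exists i1, i2; split=> //; split.
    apply: (@leq_trans (i1.+1 * l2)%N); last by rewrite leq_mul2r i1l orbT.
    by rewrite mulSn addnC ltn_add2r.
  by rewrite /A divnMDl// divn_small// addn0 modnMDl modn_small.
exists (l1 * l2)%N, (fun i => a1 (i %/ l2)%N + a2 (i %% l2)%N), A; split=> //.
- exact: leq_mul.
- by move=> i /div_lt[i1 i2]; apply: measurableI; [exact: mA1|exact: mA2].
- apply/seteqP; split=> // x _.
  by have [i1 [i2 [_ _ _ _ [il Ax]]]] := coverA x; exists (i1 * l2 + i2)%N.
- apply/funext => x; have [i1 [i2 [i1l i2l A1x A2x [il Ax]]]] := coverA x.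
  have l20 : (0 < l2)%N by apply: leq_ltn_trans i2l.
  rewrite /= h1E h2E (sum_indic_partition a1 tA1 i1l A1x).
  rewrite (sum_indic_partition a2 tA2 i2l A2x).
  rewrite (sum_indic_partition (fun i => a1 (i %/ l2)%N + a2 (i %% l2)%N)
    tA il Ax).
  by rewrite divnMDl// divn_small// addn0 modnMDl modn_small.
Qed.

Lemma Gpk_sum (k n : nat) (H : nat -> T -> R) :
  (forall i, (i < n)%N -> Gpk mu p k (H i)) ->
  Gpk mu p (k ^ n) (fun x => \sum_(i < n) H i x).
Proof.
elim: n => [_|n IH HG].
  rewrite (_ : (fun x => _) = fun=> 0); first exact: Gpk0.
  by apply/funext => x; rewrite big_ord0.
rewrite expnSr (_ : (fun x => _) = (fun x => \sum_(i < n) H i x) \+ H n); last first.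
  by apply/funext => x; rewrite big_ord_recr.
by apply: GpkD; [apply: IH => i il; apply: HG; exact: ltnW|exact: HG].
Qed.

Lemma Npe_le (eps : R) (k : nat) S :
  (1 <= k)%N -> approx_by mu p eps k S -> (Npe mu p eps S <= k%:R%:E)%E.
Proof. by move=> k1 Sk; apply: ereal_inf_lbound; exists k. Qed.

(** A nonempty set of naturals has a least element, so a finite infimum is a minimum. *)
Lemma Npe_attained (eps : R) S : (Npe mu p eps S < +oo)%E ->
  exists k : nat, [/\ (1 <= k)%N, approx_by mu p eps k S & Npe mu p eps S = k%:R%:E].
Proof.
move=> /ereal_inf_lt[_ [k0 Sk0 _] _].
have ex : exists k, `[< (1 <= k)%N /\ approx_by mu p eps k S >].
  by exists k0; exact/asboolP.
case: (ex_minnP ex) => k /asboolP[k1 Sk] kmin; exists k; split=> //.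
apply/eqP; rewrite eq_le Npe_le//=; apply/ereal_infP => _ [j Sj <-].
by rewrite lee_fin ler_nat; apply: kmin; exact/asboolP.
Qed.

(** The exponents [r / (r - 1)] and [1 - 1/r] are inverse, so [s > x^(r/(r-1))] becomes
    [x < s^(1 - 1/r)]. The [+1] after truncation makes this strict, leaving room to pass to the
    closure of the hull. *)
Lemma s_exp_gt (C K eps eta : R) : 0 <= C * K -> 0 < eps -> 0 < eta ->
  C * K * (s_exp p C K eps eta)%:R `^ ((Num.min p 2)^-1 - 1) < eta * eps.
Proof.
move=> CK0 eps0 eta0; rewrite /s_exp.
set r := Num.min p 2; set x := C * K / _; set s := (_.+1%:R : R).
have r1 : 1 < r by rewrite /r lt_min p1/=; lra.
have ee0 : 0 < eta * eps by rewrite mulr_gt0.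
have x0 : 0 <= x by rewrite divr_ge0// ltW.
have xs : x `^ (r / (r - 1)) < s by exact: truncnS_gt.
have s0 : 0 < s by rewrite ltr0n.
have e0 : 0 < 1 - r^-1 by rewrite subr_gt0 invf_lt1//; lra.
have : x < s `^ (1 - r^-1).
  have re : r / (r - 1) * (1 - r^-1) = 1 by field; rewrite !gt_eqF//; lra.
  rewrite -[ltLHS]powRr1// -[X in _ `^ X < _]re.
  by rewrite powRrM gt0_ltr_powR ?nnegrE ?powR_ge0// ltW.
move=> xs'; have -> : C * K = x * (eta * eps) by rewrite /x divfK// gt_eqF.
rewrite -(opprB 1) powRN ltr_pdivrMr ?powR_gt0//.
by rewrite [ltLHS]mulrC ltr_pM2l.
Qed.

(** Three errors add up to [eps]: [del] from [f] to a point [g] of the hull, [C (K + del) q] from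
    [g] to an average of [s] elements of [S], and [(1 - eta) eps] from these elements to simple
    functions. *)
Lemma setAK_approx (C : R) (S : set (T -> R)) (K eps eta : R) (k : nat) :
  0 < C -> maurey_constant mu p C -> S `<=` inLp mu p ->
  0 <= K -> 0 < eps -> 0 < eta ->
  approx_by mu p ((1 - eta) * eps) k S ->
  approx_by mu p eps (k ^ s_exp p C K eps eta) (setAK mu p K S).
Proof.
move=> C0 mauC SLp K0 eps0 eta0 Sk f [[fLp fco] fK].
have := @s_exp_gt C K eps eta (mulr_ge0 (ltW C0) K0) eps0 eta0.
set s := s_exp _ _ _ _ _; set q := s%:R `^ _ => sgt.
have s0 : (0 < s)%N by [].
have q0 : 0 <= q by exact: powR_ge0.
have Cq : 0 < 1 + C * q by rewrite ltr_pwDl// mulr_ge0// ltW.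
(* The solution of [del + C (K + del) q = eta eps]; it is positive by the strict bound on [s]. *)
pose del := (eta * eps - C * K * q) / (1 + C * q).
have del0 : 0 < del by rewrite divr_gt0// subr_gt0.
have [g [gS fg]] := fco del del0.
have mf := inLp_measurable fLp.
have mS h : S h -> measurable_fun setT h by move/SLp/inLp_measurable.
have mg : measurable_fun setT g by exact: conv_hull_measurable SLp gS.
(* Moving from [f] to [g] enlarges the distance to [S] from [K] to at most [K + del]. *)
have [|h Sh|F [FS gF]] := mauC S g (K + del) s SLp gS _ _ s0.
- by rewrite addr_ge0// ltW.
- apply: le_trans (Lpdist_triangle mu p1 (mS h Sh) mf mg) _.
  by rewrite EFinD leeD// LpdistC//; exact: fK.
have /choice[H HP] : forall i, exists h, (i < s)%N ->
    Gpk mu p k h /\ (Lpdist mu p (F i) h <= ((1 - eta) * eps)%:E)%E.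
  move=> i; have [/FS/Sk[h hP]|_] := boolP (i < s)%N; first by exists h.
  by exists (fun=> 0).
exists (fun x => s%:R^-1 * \sum_(i < s) H i x); split.
  by apply: GpkZ; apply: Gpk_sum => i /HP[].
have mH i : (i < s)%N -> measurable_fun setT (H i).
  by move=> /HP[[/inLp_measurable]].
have mF i : (i < s)%N -> measurable_fun setT (F i) by move=> /FS/mS.
have mavg (G : nat -> T -> R) : (forall i, (i < s)%N -> measurable_fun setT (G i)) ->
    measurable_fun setT (fun x => s%:R^-1 * \sum_(i < s) G i x).
  move=> mG; apply: measurable_funM => //; apply: measurable_sum => i; exact: mG.
apply: le_trans (Lpdist_triangle mu p1 mf mg (mavg H mH)) _.
apply: (@le_trans _ _ (del%:E + ((C * (K + del) * q)%:E + ((1 - eta) * eps)%:E))%E).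
  apply: leeD => //; apply: le_trans (Lpdist_triangle mu p1 mg (mavg F mF) (mavg H mH)) _.
  by apply: leeD => //; apply: Lpdist_mean => // i /HP[].
rewrite -!EFinD lee_fin le_eqVlt; apply/orP; left; apply/eqP.
by rewrite /del; field; rewrite gt_eqF.
Qed.

(** A point of the closure is within 1 of the hull, and hull and [S] both lie in the ball of radius
    [|M|]. The absolute value covers a negative [M], possible when [S] is empty. *)
Lemma closed_conv_hull_setAK (S : set (T -> R)) : S `<=` inLp mu p ->
  Lp_bounded mu p S -> exists2 K, 0 <= K & closed_conv_hull mu p S `<=` setAK mu p K S.
Proof.
move=> SLp [M SM]; exists (1 + (`|M| + `|M|)); first by rewrite !addr_ge0.
move=> f fco; split=> // g Sg; have [fLp /(_ 1 ltr01)[h [hS fh]]] := fco.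
have mf := inLp_measurable fLp.
have mg : measurable_fun setT g by apply: inLp_measurable; exact: SLp.
have mh : measurable_fun setT h by exact: conv_hull_measurable SLp hS.
have SM' u : S u -> (Lnorm mu p%:E (EFin \o u) <= `|M|%:E)%E.
  by move=> /SM/le_trans; apply; rewrite lee_fin ler_norm.
have m0 : measurable_fun setT (fun _ : T => 0 : R) by exact: measurable_cst.
have dist0 u : Lpdist mu p u (fun=> 0) = Lnorm mu p%:E (EFin \o u).
  by apply: eq_Lnorm => x /=; rewrite subr0.
apply: le_trans (Lpdist_triangle mu p1 mf mh mg) _.
rewrite EFinD leeD//; apply: le_trans (Lpdist_triangle mu p1 mh m0 mg) _.
rewrite EFinD leeD//; last by rewrite LpdistC// dist0 SM'.
rewrite dist0; have [n [lam [fs [_ fsS lam1 ->]]]] := hS.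
rewrite -[leRHS]mul1e -lam1 -EFinM mulr_suml.
apply: (Lnorm_sum p1 (F := fun i x => lam i * fs i x)) => i;
  have [lam0 Sfs] := fsS i (ltn_ord i).
  by apply: measurable_funM => //; apply: inLp_measurable; exact: SLp.
rewrite LnormZl//; last by apply: inLp_measurable; exact: SLp.
by rewrite EFinM ger0_norm// lee_wpmul2l ?lee_fin// SM'.
Qed.

End approx.

(** * Approximation numbers of the sets A_K and of closed convex hulls *)

Theorem theorem4p22 (d : measure_display) (T : measurableType d) (R : realType)
  (mu : {measure set T -> \bar R}) (p : R) :
  mu setT <> 0%E -> 1 < p ->
  (exists C : R, 0 < C /\
    forall S : set (T -> R), S `<=` inLp mu p -> unif_approx mu p S ->
    forall K : R, 0 <= K ->
      unif_approx mu p (setAK mu p K S) /\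
      forall eps : R, 0 < eps ->
        (Npe mu p eps (setAK mu p K S) <=
         ereal_inf [set ((fine (Npe mu p ((1 - eta) * eps) S)) ^+ s_exp p C K eps eta)%:E
                   | eta in [set eta : R | (0 < eta < 1)%R]])%E)
  /\
  (forall S : set (T -> R), S `<=` inLp mu p -> Lp_bounded mu p S -> unif_approx mu p S ->
     unif_approx mu p (closed_conv_hull mu p S)).
Proof.
move=> _ p1; have [C C0 mauC] := maurey mu p1.
have key S K eps eta : S `<=` inLp mu p -> unif_approx mu p S -> 0 <= K ->
    0 < eps -> 0 < eta < 1 -> exists k : nat,
    [/\ (1 <= k)%N, approx_by mu p eps (k ^ s_exp p C K eps eta) (setAK mu p K S)
      & Npe mu p ((1 - eta) * eps) S = k%:R%:E].
  move=> SLp uS K0 eps0 /andP[eta0 eta1].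
  have /uS/Npe_attained[k [k1 Sk Nk]] : 0 < (1 - eta) * eps.
    by rewrite mulr_gt0// subr_gt0.
  by exists k; split=> //; exact: setAK_approx C0 mauC _ _ _ _ _.
have uK S K : S `<=` inLp mu p -> unif_approx mu p S -> 0 <= K ->
    unif_approx mu p (setAK mu p K S).
  move=> SLp uS K0 eps eps0.
  (* Finiteness follows from any [eta] in (0, 1); one half is an arbitrary choice. *)
  have [|k [k1 Sk _]] := key S K eps 2^-1 SLp uS K0 eps0; first by lra.
  by apply: le_lt_trans (Npe_le _ Sk) (ltry _); rewrite expn_gt0 k1.
split.
  exists C; split=> // S SLp uS K K0; split=> [|eps eps0]; first exact: uK.
  apply/ereal_infP => _ [eta /= eta01 <-].
  have [k [k1 Sk ->]] := key S K eps eta SLp uS K0 eps0 eta01.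
  by rewrite -natrX; apply: Npe_le Sk; rewrite expn_gt0 k1.
(* For bounded [S] the closed hull lies in some [setAK mu p K S], and approximability passes to
   subsets. *)
move=> S SLp /(closed_conv_hull_setAK p1 SLp)[K K0 SK] uS eps eps0.
have [k [k1 Sk _]] := Npe_attained (uK S K SLp uS K0 eps eps0).
by apply: le_lt_trans (Npe_le k1 _) (ltry _) => f /SK/Sk.
Qed.
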